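(* For every Lie algebra $L$ over $\mathbb Z$, we have $\delta_2(L)=\gamma_2(L)$.
   Context: $L$ is a Lie ring, i.e. a Lie algebra over $\mathbb Z$. Its lower central series is $\gamma_1(L)=L$ and, for $n\ge 1$, $\gamma_{n+1}(L)$ is the additive subgroup generated by all $[x,y]$ with $x\in L$, $y\in\gamma_n(L)$. $\mathscr U(L)$ is the universal enveloping algebra of $L$ over $\mathbb Z$, $\iota:L\to\mathscr U(L)$ is the natural map (injective over $\mathbb Z$), and $\varpi(L)$ is the augmentation ideal of $\mathscr U(L)$, i.e. the two-sided ideal generated by $\iota(L)$; $\varpi^n(L)$ is its $n$th power. The $n$th Lie dimension subring is $\delta_n(L)=L\cap\varpi^n(L)=\{x\in L:\iota(x)\in\varpi^n(L)\}$, $n\ge1$. *)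

(* Defs.v *)
From HB Require Import structures.
From mathcomp Require Import all_boot all_algebra.
From mathcomp Require Import generic_quotient ring_quotient.
From mathcomp Require Import boolp classical_sets.
From mathcomp Require Import finmap monalg.

Set Implicit Arguments.
Unset Strict Implicit.
Unset Printing Implicit Defensive.

Import GRing.Theory.
Local Open Scope ring_scope.
Local Open Scope classical_set_scope.
Local Open Scope quotient_scope.

HB.mixin Record isLieRing L of GRing.Zmodule L := {
  lie : L -> L -> L;
  lieDl : forall x y z, lie (x + y) z = lie x z + lie y z;
  lieDr : forall x y z, lie x (y + z) = lie x y + lie x z;
  liexx : forall x, lie x x = 0;
  lie_jacobi : forall x y z,
    lie x (lie y z) + lie y (lie z x) + lie z (lie x y) = 0
}.

#[short(type="lieRingType")]
HB.structure Definition LieRing := {L of GRing.Zmodule L & isLieRing L}.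

Section Subgroups.
Variable V : zmodType.

Definition additive_subgroup (A : set V) : Prop :=
  A 0 /\ forall x y, A x -> A y -> A (x - y).

Definition subgroup_gen (S : set V) : set V := smallest additive_subgroup S.

End Subgroups.

Section Ideals.
Variable R : pzRingType.

Definition two_sided_ideal (I : set R) : Prop :=
  additive_subgroup I /\ forall a x, I x -> I (a * x) /\ I (x * a).

Definition ideal_gen (S : set R) : set R := smallest two_sided_ideal S.

Definition ideal_mul (I J : set R) : set R :=
  subgroup_gen [set a * b | a in I & b in J].

(* The zeroth power is the whole ring, so that the first power of a two-sided
   ideal [I] is [I * R = I]. *)
Fixpoint ideal_exp (I : set R) (n : nat) : set R :=
  if n is m.+1 then ideal_mul I (ideal_exp I m) else setT.

Lemma ideal_gen_ideal (S : set R) : two_sided_ideal (ideal_gen S).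
Proof.
split; first split=> [A [[[A0 _] _] _]//|x y Sx Sy A SA].
  by case: (SA) => -[[_ AB] _] _; apply: AB; [apply: Sx | apply: Sy].
move=> a x Sx; split=> A SA; case: (SA) => -[_ AM] _.
  by have [] := AM a _ (Sx A SA).
by have [] := AM a _ (Sx A SA).
Qed.

Lemma ideal_exp1 (I : set R) : two_sided_ideal I -> ideal_exp I 1 = I.
Proof.
move=> [IG IM]; apply/seteqP; split.
  by apply: smallest_sub => // _ [a Ia] [b _] <-; have [] := IM b _ Ia.
by move=> x Ix A [_]; apply; exists x => //; exists 1 => //; rewrite mulr1.
Qed.

End Ideals.

Section IdealQuotient.
Variables (R : pzRingType) (S : set R).

(* The library builds quotients by boolean predicates only, and quotient rings
   in the commutative case only; hence the classical truth value and the
   multiplication below. *)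
Definition ideal_genb : R -> bool := fun x => `[< ideal_gen S x >].

Lemma ideal_genP x : reflect (ideal_gen S x) (x \in ideal_genb).
Proof. exact: asboolP. Qed.

Lemma ideal_genb_zmod_closed : zmod_closed ideal_genb.
Proof.
have [[I0 IB] _] := ideal_gen_ideal S.
split=> [|x y /ideal_genP xI /ideal_genP yI]; first exact/ideal_genP.
by apply/ideal_genP; apply: IB.
Qed.

HB.instance Definition _ :=
  GRing.isZmodClosed.Build R ideal_genb ideal_genb_zmod_closed.

Definition ideal_gen_pred : zmodClosed R :=
  GRing.ZmodClosed.clone R ideal_genb _.

Definition ideal_quotient : Type := Quotient.quot ideal_gen_pred.

HB.instance Definition _ := GRing.Zmodule.on ideal_quotient.
HB.instance Definition _ : EqQuotient R (Quotient.equiv ideal_gen_pred)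
  ideal_quotient := EqQuotient.on ideal_quotient.

Definition ideal_pi : R -> ideal_quotient := \pi_ideal_quotient.

Lemma ideal_piP x y : reflect (ideal_gen S (x - y)) (ideal_pi x == ideal_pi y).
Proof. by rewrite /ideal_pi -Quotient.idealrBE; apply: ideal_genP. Qed.

Lemma ideal_pi_repr u : ideal_pi (repr u) = u.
Proof. exact: reprK. Qed.

Lemma ideal_pi_zmod_morphism : zmod_morphism ideal_pi.
Proof. by move=> x y; rewrite /ideal_pi !piE. Qed.

HB.instance Definition _ :=
  GRing.isZmodMorphism.Build R ideal_quotient ideal_pi ideal_pi_zmod_morphism.

Definition ideal_quotient_mul (u v : ideal_quotient) : ideal_quotient :=
  ideal_pi (repr u * repr v).

Lemma ideal_pi_mul x y :
  ideal_pi (x * y) = ideal_quotient_mul (ideal_pi x) (ideal_pi y).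
Proof.
have [_ IM] := ideal_gen_ideal S.
apply/eqP/ideal_piP/ideal_genP.
set x' := repr _; set y' := repr _.
have -> : x * y - x' * y' = x * (y - y') + (x - x') * y'.
  by rewrite mulrBr mulrBl addrA subrK.
apply: (rpredD (S := ideal_gen_pred)).
  apply/ideal_genP; have [|] // := IM x (y - y').
  by apply/ideal_piP; rewrite ideal_pi_repr.
apply/ideal_genP; have [|] // := IM y' (x - x').
by apply/ideal_piP; rewrite ideal_pi_repr.
Qed.

Lemma ideal_quotient_mulA : associative ideal_quotient_mul.
Proof.
move=> u v w; rewrite -[u]ideal_pi_repr -[v]ideal_pi_repr -[w]ideal_pi_repr.
by rewrite -!ideal_pi_mul mulrA.
Qed.

Lemma ideal_quotient_mul1l : left_id (ideal_pi 1) ideal_quotient_mul.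
Proof. by move=> u; rewrite -[u]ideal_pi_repr -ideal_pi_mul mul1r. Qed.

Lemma ideal_quotient_mul1r : right_id (ideal_pi 1) ideal_quotient_mul.
Proof. by move=> u; rewrite -[u]ideal_pi_repr -ideal_pi_mul mulr1. Qed.

Lemma ideal_quotient_mulDl : left_distributive ideal_quotient_mul +%R.
Proof.
move=> u v w; rewrite -[u]ideal_pi_repr -[v]ideal_pi_repr -[w]ideal_pi_repr.
by rewrite -!ideal_pi_mul -!raddfD -ideal_pi_mul mulrDl.
Qed.

Lemma ideal_quotient_mulDr : right_distributive ideal_quotient_mul +%R.
Proof.
move=> u v w; rewrite -[u]ideal_pi_repr -[v]ideal_pi_repr -[w]ideal_pi_repr.
by rewrite -!ideal_pi_mul -!raddfD -ideal_pi_mul mulrDr.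
Qed.

HB.instance Definition _ := GRing.Zmodule_isPzRing.Build ideal_quotient
  ideal_quotient_mulA ideal_quotient_mul1l ideal_quotient_mul1r
  ideal_quotient_mulDl ideal_quotient_mulDr.

Lemma ideal_pi_monoid_morphism : monoid_morphism ideal_pi.
Proof. by split=> // x y; rewrite ideal_pi_mul. Qed.

HB.instance Definition _ := GRing.isMonoidMorphism.Build R ideal_quotient
  ideal_pi ideal_pi_monoid_morphism.

End IdealQuotient.

Section LowerCentral.
Variable L : lieRingType.

(* The index 0 is not used. *)
Fixpoint lower_central (n : nat) : set L :=
  if n is (_.+1 as m).+1
  then subgroup_gen [set lie x y | x in setT & y in lower_central m]
  else setT.

End LowerCentral.

Section Enveloping.
Variable L : lieRingType.

Definition free_ring : nzRingType := {malg int[{fmonom L}]}.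

Definition free_gen (x : L) : free_ring := << fmu x >>.

(* The tensor algebra of the additive group [L] is the free ring on the set [L]
   modulo the relators [free_gen (x + y) - (free_gen x + free_gen y)]; scalars
   being integers, these already force linearity. Its quotient by the relators
   x (x) y - y (x) x - [x, y] is the enveloping algebra. *)
Definition enveloping_relators : set free_ring :=
  [set free_gen (x + y) - (free_gen x + free_gen y) | x in setT & y in setT] `|`
  [set free_gen x * free_gen y - free_gen y * free_gen x - free_gen (lie x y)
     | x in setT & y in setT].

Definition enveloping : pzRingType := ideal_quotient enveloping_relators.

Definition enveloping_inj (x : L) : enveloping :=
  ideal_pi enveloping_relators (free_gen x).

Lemma enveloping_injD x y :
  enveloping_inj (x + y) = enveloping_inj x + enveloping_inj y.
Proof.
rewrite /enveloping_inj -raddfD; apply/eqP/ideal_piP.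
by apply: sub_gen_smallest; left; exists x => //; exists y.
Qed.

Lemma enveloping_inj_lie x y : enveloping_inj (lie x y) =
  enveloping_inj x * enveloping_inj y - enveloping_inj y * enveloping_inj x.
Proof.
rewrite /enveloping_inj -!rmorphM -raddfB; apply/esym/eqP/ideal_piP.
by apply: sub_gen_smallest; right; exists x => //; exists y.
Qed.

Lemma free_ring_decomp (p : free_ring) :
  p = \sum_(m <- msupp p) (\prod_(x <- m) free_gen x) *~ mcoeff m p.
Proof.
rewrite {1}[p]monalgE; apply: eq_bigr => m _.
have -> : \prod_(x <- m) free_gen x = << m >>.
  case: m => s; elim: s => [|x s IH]; first by rewrite big_nil -fmoneE.
  rewrite big_cons IH /free_gen malgM_def fgmulUU mul1r fmuE.
  by congr << _ >>; apply: fmmulE.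
apply/malgP => k; rewrite raddfMz /= !mcoeffU.
by case: (m == k); rewrite ?mulr0n ?mul0rz // mulr1n intz.
Qed.

Section UniversalProperty.
Variables (A : nzRingType) (f : L -> A).
Hypothesis fD : forall x y, f (x + y) = f x + f y.
Hypothesis f_lie : forall x y, f (lie x y) = f x * f y - f y * f x.

Definition monom_eval (m : {fmonom L}) : A := \prod_(x <- m) f x.

Lemma monom_eval_mmorphism : mmorphism monom_eval.
Proof.
split=> [m1 m2|]; rewrite /monom_eval ?fm1 ?big_nil //.
by rewrite fmM big_cat.
Qed.

HB.instance Definition _ :=
  isMultiplicative.Build {fmonom L} A monom_eval monom_eval_mmorphism.

Definition free_eval : free_ring -> A := mmap intr monom_eval.

Lemma free_eval_zmod_morphism : zmod_morphism free_eval.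
Proof. exact: mmap_is_additive. Qed.

Lemma free_eval_monoid_morphism : monoid_morphism free_eval.
Proof.
have [fM f1] : multiplicative free_eval.
  apply: commr_mmap_is_multiplicative => g m m'.
  exact/commr_sym/commr_int.
by split.
Qed.

HB.instance Definition _ := GRing.isZmodMorphism.Build free_ring A free_eval
  free_eval_zmod_morphism.
HB.instance Definition _ := GRing.isMonoidMorphism.Build free_ring A free_eval
  free_eval_monoid_morphism.

Lemma free_eval_gen x : free_eval (free_gen x) = f x.
Proof.
by rewrite /free_eval mmapU mul1r /monom_eval fmU big_seq1.
Qed.

Lemma free_eval_relators :
  ideal_gen enveloping_relators `<=` [set p | free_eval p = 0].
Proof.
apply: smallest_sub; last first.
  move=> _ [] [x _] [y _] <- /=.
    by rewrite raddfB raddfD /= !free_eval_gen fD subrr.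
  by rewrite !rmorphB !rmorphM /= !free_eval_gen f_lie subrr.
split=> [|a x /= x0]; last by rewrite !rmorphM /= x0 mulr0 mul0r.
by split=> [|x y /= x0 y0]; rewrite /= ?raddf0 // raddfB /= x0 y0 subr0.
Qed.

Definition enveloping_eval (u : enveloping) : A := free_eval (repr u).

Lemma enveloping_eval_pi p :
  enveloping_eval (ideal_pi enveloping_relators p) = free_eval p.
Proof.
apply/eqP; rewrite -subr_eq0 -raddfB; apply/eqP/free_eval_relators.
by apply/ideal_piP; rewrite ideal_pi_repr.
Qed.

Lemma enveloping_eval_zmod_morphism : zmod_morphism enveloping_eval.
Proof.
move=> u v; rewrite -[u]ideal_pi_repr -[v]ideal_pi_repr -raddfB.
by rewrite !enveloping_eval_pi raddfB.
Qed.

Lemma enveloping_eval_monoid_morphism : monoid_morphism enveloping_eval.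
Proof.
split=> [|u v].
  by rewrite -(rmorph1 (ideal_pi _)) enveloping_eval_pi rmorph1.
rewrite -[u]ideal_pi_repr -[v]ideal_pi_repr -rmorphM.
by rewrite !enveloping_eval_pi rmorphM.
Qed.

HB.instance Definition _ := GRing.isZmodMorphism.Build enveloping A
  enveloping_eval enveloping_eval_zmod_morphism.
HB.instance Definition _ := GRing.isMonoidMorphism.Build enveloping A
  enveloping_eval enveloping_eval_monoid_morphism.

Lemma enveloping_eval_inj x : enveloping_eval (enveloping_inj x) = f x.
Proof. exact: etrans (enveloping_eval_pi _) (free_eval_gen x). Qed.

Lemma enveloping_eval_unique (g : {rmorphism enveloping -> A}) :
  (forall x, g (enveloping_inj x) = f x) -> g =1 enveloping_eval.
Proof.
move=> gf u; rewrite -[u]ideal_pi_repr enveloping_eval_pi.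
rewrite (free_ring_decomp (repr u)) !raddf_sum /=; apply: eq_bigr => m _.
rewrite !raddfMz /= !rmorph_prod; congr (_ *~ _).
by apply: eq_bigr => x _; rewrite gf /= free_eval_gen.
Qed.

End UniversalProperty.

Definition augmentation_ideal : set enveloping :=
  ideal_gen (range enveloping_inj).

Definition lie_dimension (n : nat) : set L :=
  [set x | ideal_exp augmentation_ideal n (enveloping_inj x)].

End Enveloping.

Arguments lower_central : clear implicits.
Arguments lie_dimension : clear implicits.

(* Main.v *)
Require Import Defs.
From mathcomp Require Import all_boot all_algebra.
From mathcomp Require Import classical_sets.
From HB Require Import structures.
From mathcomp Require Import generic_quotient ring_quotient boolp.

(** The inclusion of [gamma_2] in [delta_2] holds because a bracket becomes a
    commutator [x * y - y * x] in the enveloping algebra, and this lies in the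
    square of the augmentation ideal.

    For the converse, a ring in which the square of the augmentation ideal
    dies, but the abelianization of [L] survives, is enough.  For an abelian
    group [M], the square-zero extension [int * M] is such a ring: the subgroup
    [M] is an ideal with zero multiplication.  Take [M] to be the quotient of
    [L] by [gamma_2].  The map sending [x] to [(0, class of x)] respects
    brackets, since both [lie x y] and the commutator of the images of [x] and
    [y] go to zero; hence it extends to the enveloping algebra.  The extension
    maps the augmentation ideal into [M], hence its square to zero, so an
    element of [delta_2] has trivial class modulo [gamma_2]. *)

Set Implicit Arguments.
Unset Strict Implicit.
Unset Printing Implicit Defensive.

Import GRing.Theory.
Local Open Scope ring_scope.
Local Open Scope classical_set_scope.
Local Open Scope quotient_scope.

Lemma subgroup_gen_subgroup (V : zmodType) (S : set V) :
  additive_subgroup (subgroup_gen S).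
Proof.
split=> [A [[]]//|x y Sx Sy A SA].
by case: (SA) => -[_ AB] _; apply: AB; [apply: Sx | apply: Sy].
Qed.

Lemma ideal_exp2 (R : pzRingType) (I : set R) :
  two_sided_ideal I -> ideal_exp I 2 = ideal_mul I I.
Proof. by move=> II; rewrite -{3}(ideal_exp1 II). Qed.

Section SquareZeroExtension.
Variable M : zmodType.

(** A fresh name for the product group, so that the multiplication below does
    not compete with the componentwise one. *)
Definition square_zero_ext : Type := (int * M)%type.

HB.instance Definition _ := GRing.Zmodule.on square_zero_ext.

Definition square_zero_one : square_zero_ext := (1, 0).

Definition square_zero_mul (u v : square_zero_ext) : square_zero_ext :=
  (u.1 * v.1, v.2 *~ u.1 + u.2 *~ v.1).

Lemma square_zero_mulA : associative square_zero_mul.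
Proof.
move=> [a m] [b n] [c p]; rewrite /square_zero_mul /= mulrA !mulrzDl.
by rewrite -!mulrzA addrA (mulrC b a) (mulrC c a).
Qed.

Lemma square_zero_mul1l : left_id square_zero_one square_zero_mul.
Proof. by case=> a m; rewrite /square_zero_mul /= mul1r mul0rz addr0. Qed.

Lemma square_zero_mul1r : right_id square_zero_one square_zero_mul.
Proof. by case=> a m; rewrite /square_zero_mul /= mulr1 mul0rz add0r. Qed.

Lemma square_zero_mulDl : left_distributive square_zero_mul +%R.
Proof.
move=> [a m] [b n] [c p]; congr pair; rewrite /= ?mulrDl //.
by rewrite mulrzDr mulrzDl addrACA.
Qed.

Lemma square_zero_mulDr : right_distributive square_zero_mul +%R.
Proof.
move=> [a m] [b n] [c p]; congr pair; rewrite /= ?mulrDr //.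
by rewrite mulrzDr mulrzDl addrACA.
Qed.

Lemma square_zero_one_neq0 : square_zero_one != 0.
Proof. by []. Qed.

HB.instance Definition _ := GRing.Zmodule_isNzRing.Build square_zero_ext
  square_zero_mulA square_zero_mul1l square_zero_mul1r
  square_zero_mulDl square_zero_mulDr square_zero_one_neq0.

Definition square_zero_in (m : M) : square_zero_ext := (0, m).

Lemma square_zero_mul0 (u v : square_zero_ext) :
  u.1 = 0 -> v.1 = 0 -> u * v = 0.
Proof.
case: u v => [a m] [b n] /= -> ->.
by congr pair; rewrite ?mulr0 //= !mulr0z addr0.
Qed.

End SquareZeroExtension.

Section SecondDimensionSubring.
Variable L : lieRingType.
Local Notation varpi := (@augmentation_ideal L).

Lemma ideal_exp2_augmentation : ideal_exp varpi 2 = ideal_mul varpi varpi.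
Proof. exact/ideal_exp2/ideal_gen_ideal. Qed.

Lemma lower_central2_sub : lower_central L 2 `<=` lie_dimension L 2.
Proof.
rewrite /lie_dimension ideal_exp2_augmentation.
have injB : zmod_morphism (@enveloping_inj L).
  by move=> x y; apply/eqP; rewrite eq_sym subr_eq -enveloping_injD subrK.
have [W0 WB] : additive_subgroup (ideal_mul varpi varpi).
  exact: subgroup_gen_subgroup.
have augI x : varpi (enveloping_inj x).
  by apply: sub_gen_smallest; exists x.
apply: smallest_sub => [|_ [x _] [y _] <-] /=.
  split=> [|x y /= Wx Wy]; last by rewrite /= injB; apply: WB.
  by rewrite /= -(subrr 0) injB subrr.
rewrite enveloping_inj_lie; apply: WB; apply: sub_gen_smallest.
  by exists (enveloping_inj x) => //; exists (enveloping_inj y).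
by exists (enveloping_inj y) => //; exists (enveloping_inj x).
Qed.

(** An additive map [p] that kills brackets, placed in the square-zero ideal of
    the extension by [M], satisfies the relations of the enveloping algebra
    because products inside that ideal vanish.  The induced ring morphism agrees
    with [p] on [L] and kills the square of the augmentation ideal, which
    forces [p] to vanish on [delta_2]. *)
Lemma lie_dimension2_ker (M : zmodType) (p : L -> M) :
    {morph p : x y / x + y} -> (forall x y, p (lie x y) = 0) ->
  lie_dimension L 2 `<=` [set x | p x = 0].
Proof.
move=> pD p_lie x; rewrite /lie_dimension ideal_exp2_augmentation /=.
pose f y := square_zero_in (p y).
have fD y z : f (y + z) = f y + f z.
  by rewrite /f pD; congr pair; rewrite /= addr0.
have f_lie y z : f (lie y z) = f y * f z - f z * f y.
  by rewrite !square_zero_mul0 // subr0 /f p_lie.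
pose g := enveloping_eval f.
have gB : zmod_morphism g by apply: enveloping_eval_zmod_morphism.
have [_ gM] : monoid_morphism g by apply: enveloping_eval_monoid_morphism.
have g0 : g 0 = 0 by rewrite -(subrr 0) gB subrr.
have g_inj y : g (enveloping_inj y) = f y by apply: enveloping_eval_inj.
have g_aug : varpi `<=` [set u | (g u).1 = 0].
  apply: smallest_sub => [|_ [y _ <-]]; last by rewrite /= g_inj.
  split; first split=> [|u v /= gu gv]; rewrite /= ?g0 //.
    by rewrite gB /= gu gv subr0.
  by move=> a u /= gu; rewrite !gM /= gu mulr0 mul0r.
suff g_aug2 : ideal_mul varpi varpi `<=` [set u | g u = 0].
  by move=> /g_aug2 /=; rewrite g_inj => -[].
apply: smallest_sub => [|_ [u Iu] [v Iv] <-] /=.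
  by split=> [|u v /= gu gv]; rewrite /= ?g0 // gB gu gv subr0.
by rewrite gM; apply: square_zero_mul0; apply: g_aug.
Qed.

(** The quotient construction takes a boolean predicate, whence the classical
    truth value. *)
Definition derivedb : L -> bool := fun x => `[< lower_central L 2 x >].

Lemma derivedb_zmod_closed : zmod_closed derivedb.
Proof.
have [D0 DB] : additive_subgroup (lower_central L 2).
  exact: subgroup_gen_subgroup.
by split=> [|x y /asboolP Dx /asboolP Dy]; apply/asboolP => //; apply: DB.
Qed.

HB.instance Definition _ :=
  GRing.isZmodClosed.Build L derivedb derivedb_zmod_closed.

Definition derived_pred : zmodClosed L := GRing.ZmodClosed.clone L derivedb _.

Definition abelianization : zmodType := Quotient.quot derived_pred.

Definition abelianize : L -> abelianization := \pi_(Quotient.quot derived_pred).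

Lemma abelianizeD : {morph abelianize : x y / x + y}.
Proof. by move=> x y; rewrite /abelianize !piE. Qed.

Lemma abelianize_eq0 x : abelianize x = 0 <-> lower_central L 2 x.
Proof.
have -> : (0 : abelianization) = abelianize 0 by rewrite /abelianize !piE.
apply: (iff_trans (rwP eqP)).
rewrite /abelianize -Quotient.idealrBE subr0.
exact: (iff_sym (rwP (asboolP _))).
Qed.

Lemma abelianize_lie x y : abelianize (lie x y) = 0.
Proof.
apply/abelianize_eq0.
by apply: (@sub_gen_smallest _ _ [set lie x y | x in setT & y in setT]);
  exists x => //; exists y.
Qed.

End SecondDimensionSubring.

Theorem theorem4p3 (L : lieRingType) : lie_dimension L 2 = lower_central L 2.
Proof.
apply/seteqP; split; last exact: lower_central2_sub.
move=> x /(lie_dimension2_ker (@abelianizeD L) (@abelianize_lie L)).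
by move/abelianize_eq0.
Qed.
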